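(* Let $\mathcal{C}$ be an additive category and let $F,G:\mathcal{C}\to\mathcal{C}$ be (additive, covariant) endofunctors such that $(F,G)$ is an adjoint pair, with $F$ left adjoint to $G$. Then there exists an isomorphism of categories $\mathcal{E}:\mathfrak{L}_F(\mathcal{C})\to\mathfrak{R}_G(\mathcal{C})$ given on objects by $M=(M^n,f_n)_{n\in\mathbb{Z}}\mapsto\mathcal{E}(M):=(M^n,g_n)_{n\in\mathbb{Z}}$ and on morphisms by $\varphi=(\varphi^n)\mapsto\mathcal{E}(\varphi):=\varphi$, where, for each $n\in\mathbb{Z}$, $g_n=\tau_{n,n+1}(f_n)$ is the image of $f_n$ under the natural group isomorphism $\tau_{n,n+1}:\mathrm{Hom}_{\mathcal{C}}(F(M^n),M^{n+1})\to\mathrm{Hom}_{\mathcal{C}}(M^n,G(M^{n+1}))$ given by the adjunction.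
   Context: The category $\mathfrak{L}_F(\mathcal{C})$: an object is a family $M=(M^n,f_n)_{n\in\mathbb{Z}}$ of objects $M^n$ of $\mathcal{C}$ and morphisms $f_n:F(M^n)\to M^{n+1}$ with $f_{n+1}\circ F(f_n)=0$ for all $n$. A morphism $\varphi:(M^n,f_n)\to(N^n,f'_n)$ is a family $(\varphi^n:M^n\to N^n)_{n\in\mathbb{Z}}$ with $\varphi^{n+1}\circ f_n=f'_n\circ F(\varphi^n)$ for all $n$. The category $\mathfrak{R}_G(\mathcal{C})$: an object is a family $M=(M^n,g_n)_{n\in\mathbb{Z}}$ of objects $M^n$ of $\mathcal{C}$ and morphisms $g_n:M^n\to G(M^{n+1})$ with $G(g_{n+1})\circ g_n=0$ for all $n$. A morphism $\varphi:(M^n,g_n)\to(N^n,g'_n)$ is a family $(\varphi^n:M^n\to N^n)_{n\in\mathbb{Z}}$ with $G(\varphi^{n+1})\circ g_n=g'_n\circ\varphi^n$ for all $n$. *)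

(* Defs.v *)
From HB Require Import structures.
From mathcomp Require Import all_boot all_algebra.
From mathcomp Require Import boolp.

Set Implicit Arguments.
Unset Strict Implicit.
Unset Printing Implicit Defensive.

Import GRing.Theory.
Local Open Scope ring_scope.
#[local] Obligation Tactic := idtac.

Record category : Type := Category {
  Ob :> Type;
  mor : Ob -> Ob -> Type;
  idm : forall X : Ob, mor X X;
  compm : forall X Y Z : Ob, mor Y Z -> mor X Y -> mor X Z;
  compm1 : forall (X Y : Ob) (f : mor X Y), compm f (idm X) = f;
  comp1m : forall (X Y : Ob) (f : mor X Y), compm (idm Y) f = f;
  compmA : forall (X Y Z W : Ob) (h : mor Z W) (g : mor Y Z) (f : mor X Y),
    compm h (compm g f) = compm (compm h g) f
}.

Arguments idm {c} X.
Arguments compm {c X Y Z} g f.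

Notation "g ∘ f" := (compm g f) (at level 40, left associativity).

Record functor (C D : category) : Type := Functor {
  fob :> C -> D;
  fmap : forall X Y : C, mor X Y -> mor (fob X) (fob Y);
  fmap1 : forall X : C, fmap (idm X) = idm (fob X);
  fmapM : forall (X Y Z : C) (g : mor Y Z) (f : mor X Y),
    fmap (g ∘ f) = fmap g ∘ fmap f
}.

Arguments fmap {C D} f0 {X Y} f.

Definition functor_id (C : category) : functor C C :=
  @Functor C C (fun X => X) (fun X Y f => f)
    (fun X => erefl) (fun X Y Z g f => erefl).

Program Definition functor_comp (C D E : category)
    (K : functor D E) (H : functor C D) : functor C E :=
  @Functor C E (fun X => K (H X)) (fun X Y f => fmap K (fmap H f)) _ _.
Next Obligation. by move=> C D E K H X; rewrite /= !fmap1. Qed.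
Next Obligation. by move=> C D E K H X Y Z g f; rewrite /= !fmapM. Qed.

(* Strict isomorphism, not equivalence: the composites are equal to, and not
   merely naturally isomorphic to, the identity functors. *)
Definition is_isomorphism_of_categories (C D : category) (E : functor C D) :=
  exists E' : functor D C,
    functor_comp E' E = functor_id C /\ functor_comp E E' = functor_id D.

(* [tau X Y] is the bijection Hom(F X, Y) -> Hom(X, G Y). *)
Record adjunction (C D : category) (F : functor C D) (G : functor D C) : Type :=
  Adjunction {
  tau : forall (X : C) (Y : D), mor (F X) Y -> mor X (G Y);
  tau_bij : forall (X : C) (Y : D), bijective (@tau X Y);
  tau_natl : forall (X X' : C) (Y : D) (a : mor X' X) (f : mor (F X) Y),
    tau (f ∘ fmap F a) = tau f ∘ a;
  tau_natr : forall (X : C) (Y Y' : D) (b : mor Y Y') (f : mor (F X) Y),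
    tau (b ∘ f) = fmap G b ∘ tau f
}.

Arguments tau {C D F G} a {X Y} f : rename.

(* A [zmodType] also carries a decidable equality and a choice operator; with
   the classical axioms every type has both, so no generality is lost. *)
Record preadditiveCategory : Type := PreadditiveCategory {
  preadd_cat :> category;
  mor_zmod : forall X Y : preadd_cat, GRing.Zmodule.axioms_ (mor X Y)
}.

HB.instance Definition _ (C : preadditiveCategory) (X Y : C) :=
  @mor_zmod C X Y.

Definition bilinear_comp (C : preadditiveCategory) : Prop :=
  (forall (X Y Z : C) (g g' : mor Y Z) (f : mor X Y),
     (g + g') ∘ f = g ∘ f + g' ∘ f) /\
  (forall (X Y Z : C) (g : mor Y Z) (f f' : mor X Y),
     g ∘ (f + f') = g ∘ f + g ∘ f').

Definition is_zero_object (C : category) (Z : C) : Prop :=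
  forall X : C,
    (exists f : mor Z X, forall f', f' = f) /\
    (exists f : mor X Z, forall f', f' = f).

Definition is_biproduct (C : preadditiveCategory) (A B P : C)
    (iA : mor A P) (iB : mor B P) (pA : mor P A) (pB : mor P B) : Prop :=
  [/\ pA ∘ iA = idm A, pB ∘ iB = idm B, pA ∘ iB = 0, pB ∘ iA = 0
    & iA ∘ pA + iB ∘ pB = idm P].

Record additiveCategory : Type := AdditiveCategory {
  add_preadd :> preadditiveCategory;
  add_bilinear : bilinear_comp add_preadd;
  add_zero : exists Z : add_preadd, is_zero_object Z;
  add_biprod : forall A B : add_preadd,
    exists (P : add_preadd) (iA : mor A P) (iB : mor B P)
           (pA : mor P A) (pB : mor P B), is_biproduct iA iB pA pB
}.

Definition additive_functor (C D : preadditiveCategory) (F : functor C D) :=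
  forall X Y : C, zmod_morphism (fun f : mor X Y => fmap F f).

Section LCategory.
Variables (C : preadditiveCategory) (F : functor C C).

Record Lobj : Type := LObj {
  Lcar :> int -> C;
  Lmap : forall n : int, mor (F (Lcar n)) (Lcar (n + 1));
  Lmap_sq0 : forall n : int, Lmap (n + 1) ∘ fmap F (Lmap n) = 0
}.

Record Lhom (M N : Lobj) : Type := LHom {
  Lcomp :> forall n : int, mor (M n) (N n);
  Lcomp_comm : forall n : int,
    Lcomp (n + 1) ∘ Lmap M n = Lmap N n ∘ fmap F (Lcomp n)
}.

Lemma Lhom_ext (M N : Lobj) (p q : Lhom M N) :
  (forall n, p n = q n) -> p = q.
Proof.
case: p q => [p hp] [q hq] /= pq.
have e : p = q by exact: functional_extensionality_dep.
by subst q; congr LHom; exact: Prop_irrelevance.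
Qed.

Program Definition Lid (M : Lobj) : Lhom M M :=
  @LHom M M (fun n => idm (M n)) _.
Next Obligation. by move=> M n; rewrite /= comp1m fmap1 compm1. Qed.

Program Definition Lcompose (M N P : Lobj) (q : Lhom N P) (p : Lhom M N) :
  Lhom M P := @LHom M P (fun n => q n ∘ p n) _.
Next Obligation.
by move=> M N P q p n; rewrite /= -compmA Lcomp_comm compmA Lcomp_comm fmapM compmA.
Qed.

Program Definition Lcat : category := @Category Lobj Lhom Lid Lcompose _ _ _.
Next Obligation. by move=> M N p; apply: Lhom_ext => n /=; exact: compm1. Qed.
Next Obligation. by move=> M N p; apply: Lhom_ext => n /=; exact: comp1m. Qed.
Next Obligation.
by move=> M N P Q r q p; apply: Lhom_ext => n /=; exact: compmA.
Qed.

End LCategory.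

Section RCategory.
Variables (C : preadditiveCategory) (G : functor C C).

Record Robj : Type := RObj {
  Rcar :> int -> C;
  Rmap : forall n : int, mor (Rcar n) (G (Rcar (n + 1)));
  Rmap_sq0 : forall n : int, fmap G (Rmap (n + 1)) ∘ Rmap n = 0
}.

Record Rhom (M N : Robj) : Type := RHom {
  Rcomp :> forall n : int, mor (M n) (N n);
  Rcomp_comm : forall n : int,
    fmap G (Rcomp (n + 1)) ∘ Rmap M n = Rmap N n ∘ Rcomp n
}.

Lemma Rhom_ext (M N : Robj) (p q : Rhom M N) :
  (forall n, p n = q n) -> p = q.
Proof.
case: p q => [p hp] [q hq] /= pq.
have e : p = q by exact: functional_extensionality_dep.
by subst q; congr RHom; exact: Prop_irrelevance.
Qed.

Program Definition Rid (M : Robj) : Rhom M M :=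
  @RHom M M (fun n => idm (M n)) _.
Next Obligation. by move=> M n; rewrite /= fmap1 comp1m compm1. Qed.

Program Definition Rcompose (M N P : Robj) (q : Rhom N P) (p : Rhom M N) :
  Rhom M P := @RHom M P (fun n => q n ∘ p n) _.
Next Obligation.
by move=> M N P q p n; rewrite /= fmapM -compmA Rcomp_comm compmA Rcomp_comm compmA.
Qed.

Program Definition Rcat : category := @Category Robj Rhom Rid Rcompose _ _ _.
Next Obligation. by move=> M N p; apply: Rhom_ext => n /=; exact: compm1. Qed.
Next Obligation. by move=> M N p; apply: Rhom_ext => n /=; exact: comp1m. Qed.
Next Obligation.
by move=> M N P Q r q p; apply: Rhom_ext => n /=; exact: compmA.
Qed.

End RCategory.

(* Main.v *)
Require Import Defs.
From mathcomp Require Import all_boot all_algebra.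
From mathcomp Require Import boolp.

Set Implicit Arguments.
Unset Strict Implicit.
Unset Printing Implicit Defensive.

Import GRing.Theory.
Local Open Scope ring_scope.

(** The category [Lcat F] consists of families [f_n : F M^n -> M^(n+1)] and
    [Rcat G] of families [g_n : M^n -> G M^(n+1)], so transposing every
    structure map across the adjunction matches the two kinds of data
    bijectively; the point is that the conditions on them match too.
    Transposing the composite [b ∘ F a] twice gives [G (tau b) ∘ tau a]
    ([tau_tau_comp]), so, [tau] being injective with [tau 0 = 0], one square
    condition holds exactly when the other does.  Naturality of [tau] on both
    sides does the same for the squares defining morphisms
    ([tau_square_iff]).  Hence [E] keeps the carrier and the morphism
    components, and the inverse functor is obtained by transposing back.

    Additivity of [tau] comes from the formula [tau f = G f ∘ tau (id)]: it
    exhibits [tau] as the additive map [fmap G] followed by composition with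
    the unit, which is additive by bilinearity.

    Proving that the composites are strictly equal to the identity functors
    requires comparing morphisms whose types agree only up to a proved
    equality of objects.  Such an equality is turned into a morphism
    ([eqmor]), and a functor that fixes objects is the identity as soon as
    these morphisms are natural ([eq_functor_id]).  Here every equality of
    objects keeps the carrier, so the morphism has identity components, and
    naturality is trivial. *)

(** * Recognizing the identity functor *)

Definition eqmor (C : category) (X Y : C) (e : X = Y) : mor X Y :=
  ecast Z (mor X Z) e (idm X).

(** Naturality of [eqmor] expresses that [H] fixes morphisms without casting
    one hom-type to another; once the object map is literally the identity,
    every [e X] is reflexivity by proof irrelevance and the casts vanish. *)
Lemma eq_functor_id (C : category) (H : functor C C) (e : forall X, H X = X) :
  (forall (X Y : C) (f : mor X Y),
     eqmor (e Y) ∘ fmap H f = f ∘ eqmor (e X)) ->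
  H = functor_id C.
Proof.
case: H e => o m m1 mM /= e.
have o_id : o = (fun X => X) by exact: funext.
subst o => nat_e.
have m_id : m = (fun X Y f => f).
  apply: functional_extensionality_dep => X.
  apply: functional_extensionality_dep => Y.
  apply: functional_extensionality_dep => f.
  have := nat_e X Y f.
  rewrite (Prop_irrelevance (e X) erefl) (Prop_irrelevance (e Y) erefl).
  by rewrite /eqmor /= comp1m compm1.
by subst m; congr Functor; exact: Prop_irrelevance.
Qed.

(** Used on equalities whose two sides are different terms but convertible,
    which is how the casts coming from transposing back and forth vanish. *)
Lemma eqmor_refl (C : category) (X : C) (e : X = X) : eqmor e = idm X.
Proof. by rewrite (Prop_irrelevance e erefl). Qed.

Section StructuredFamilies.
Variables (C : preadditiveCategory) (F : functor C C) (car : int -> C).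

Lemma LObj_eq (f f' : forall n, mor (F (car n)) (car (n + 1))) s s' :
  f = f' -> LObj (Lmap := f) s = LObj (Lmap := f') s'.
Proof. by move=> ff'; subst f'; congr LObj; exact: Prop_irrelevance. Qed.

(** Reduces casts between families to casts in [C], where [eqmor_refl] applies
    as soon as the two families have the same carrier. *)
Lemma Lcomp_eqmor (M N : Lcat F) (e : M = N) n :
  Lcomp (eqmor e) n = eqmor (congr1 (fun P : Lcat F => Lcar P n) e).
Proof. by case: N / e. Qed.

Lemma RObj_eq (g g' : forall n, mor (car n) (F (car (n + 1)))) s s' :
  g = g' -> RObj (Rmap := g) s = RObj (Rmap := g') s'.
Proof. by move=> gg'; subst g'; congr RObj; exact: Prop_irrelevance. Qed.

Lemma Rcomp_eqmor (M N : Rcat F) (e : M = N) n :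
  Rcomp (eqmor e) n = eqmor (congr1 (fun P : Rcat F => Rcar P n) e).
Proof. by case: N / e. Qed.

End StructuredFamilies.

(** * Transposition across an adjunction *)

Section Transposition.
Variables (C D : category) (F : functor C D) (G : functor D C).
Variable adj : adjunction F G.

Lemma tau_inj (X : C) (Y : D) : injective (@tau _ _ _ _ adj X Y).
Proof. exact: bij_inj (tau_bij adj X Y). Qed.

Lemma tau_inv_exists (X : C) (Y : D) :
  exists h : mor X (G Y) -> mor (F X) Y,
    cancel (tau adj) h /\ cancel h (tau adj).
Proof. by have [h tauK hK] := tau_bij adj X Y; exists h. Qed.

Definition tau_inv (X : C) (Y : D) : mor X (G Y) -> mor (F X) Y :=
  sval (cid (tau_inv_exists X Y)).

Lemma tauK (X : C) (Y : D) : cancel (@tau _ _ _ _ adj X Y) (@tau_inv X Y).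
Proof. by rewrite /tau_inv; case: cid => h []. Qed.

Lemma tau_invK (X : C) (Y : D) : cancel (@tau_inv X Y) (@tau _ _ _ _ adj X Y).
Proof. by rewrite /tau_inv; case: cid => h []. Qed.

(** The morphism [tau adj (idm (F X))] is the unit of the adjunction, so every
    transpose is determined by the functor [G] and the unit; this is how
    additivity passes from [G] to [tau]. *)
Lemma tau_unitE (X : C) (Y : D) (f : mor (F X) Y) :
  tau adj f = fmap G f ∘ tau adj (idm (F X)).
Proof. by rewrite -tau_natr compm1. Qed.

Lemma tau_square_iff (X X' : C) (Y Y' : D) (a : mor X X') (b : mor Y Y')
    (f : mor (F X) Y) (f' : mor (F X') Y') :
  b ∘ f = f' ∘ fmap F a <-> fmap G b ∘ tau adj f = tau adj f' ∘ a.
Proof. by rewrite -tau_natr -tau_natl; split=> [->//|/tau_inj]. Qed.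

End Transposition.

(** The inner transposition uses naturality in the first variable, the outer
    one naturality in the second. *)
Lemma tau_tau_comp (C : category) (F G : functor C C) (adj : adjunction F G)
    (X Y Z : C) (a : mor (F X) Y) (b : mor (F Y) Z) :
  tau adj (tau adj (b ∘ fmap F a)) = fmap G (tau adj b) ∘ tau adj a.
Proof. by rewrite tau_natl tau_natr. Qed.

Lemma tau_zmod_morphism (C : additiveCategory) (F G : functor C C)
    (adj : adjunction F G) (X Y : C) :
  additive_functor G -> zmod_morphism (fun f : mor (F X) Y => tau adj f).
Proof.
move=> addG f g; have [compDl _] := add_bilinear C.
(* Bilinearity speaks of sums only, so the difference is moved across. *)
apply/eqP; rewrite eq_sym subr_eq; apply/eqP.
rewrite (tau_unitE adj (f - g)) (tau_unitE adj g).
by rewrite -compDl addG subrK -tau_unitE.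
Qed.

(** The equivalence of the two square conditions: the right-hand side is a
    double transpose, and [tau] is injective and preserves zero. *)
Lemma tau_comp_eq0 (C : additiveCategory) (F G : functor C C)
    (adj : adjunction F G) (X Y Z : C) (a : mor (F X) Y) (b : mor (F Y) Z) :
  additive_functor G ->
  b ∘ fmap F a = 0 <-> fmap G (tau adj b) ∘ tau adj a = 0.
Proof.
move=> addG.
have tau0 U V : tau adj (0 : mor (F U) V) = 0.
  by have /= := tau_zmod_morphism adj addG (0 : mor (F U) V) 0; rewrite !subrr.
rewrite -tau_tau_comp; split=> [->|]; first by rewrite !tau0.
by rewrite -[X in _ = X]tau0 => /tau_inj; rewrite -[X in _ = X]tau0 => /tau_inj.
Qed.

(** * The isomorphism of categories *)

Theorem theorem5p5 (C : additiveCategory) (F G : functor C C)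
    (addF : additive_functor F) (addG : additive_functor G)
    (adj : adjunction F G) :
  (forall X Y : C,
     zmod_morphism (fun f : mor (F X) Y => tau adj f) /\
     bijective (fun f : mor (F X) Y => tau adj f)) /\
  exists (E_sq0 : forall (M : Lcat F) (n : int),
            fmap G (tau adj (Lmap M (n + 1))) ∘ tau adj (Lmap M n) = 0)
         (E_comm : forall (M N : Lcat F) (phi : mor M N) (n : int),
            fmap G (Lcomp phi (n + 1)) ∘ tau adj (Lmap M n)
            = tau adj (Lmap N n) ∘ Lcomp phi n),
  let E_ob : Lcat F -> Rcat G := fun M =>
    RObj (Rcar := Lcar M) (Rmap := fun n => tau adj (Lmap M n)) (E_sq0 M) in
  let E_map : forall M N : Lcat F, mor M N -> mor (E_ob M) (E_ob N) :=
    fun M N phi =>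
      RHom (M := E_ob M) (N := E_ob N) (Rcomp := Lcomp phi)
        (E_comm M N phi) in
  exists (E_id : forall M : Lcat F, E_map M M (idm M) = idm (E_ob M))
         (E_comp : forall (M N P : Lcat F) (psi : mor N P) (phi : mor M N),
            E_map M P (psi ∘ phi) = E_map N P psi ∘ E_map M N phi),
  let E : functor (Lcat F) (Rcat G) :=
    Functor (fob := E_ob) (fmap := E_map) E_id E_comp in
  is_isomorphism_of_categories E.
Proof.
split.
  by move=> X Y; split; [exact: tau_zmod_morphism | exact: tau_bij].
have E_sq0 (M : Lcat F) (n : int) :
    fmap G (tau adj (Lmap M (n + 1))) ∘ tau adj (Lmap M n) = 0.
  by apply/tau_comp_eq0 => //; exact: Lmap_sq0.
have E_comm (M N : Lcat F) (phi : mor M N) (n : int) :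
    fmap G (Lcomp phi (n + 1)) ∘ tau adj (Lmap M n)
    = tau adj (Lmap N n) ∘ Lcomp phi n.
  by apply/tau_square_iff; exact: Lcomp_comm.
exists E_sq0, E_comm => E_ob E_map.
have E_id M : E_map M M (idm M) = idm (E_ob M) by exact: Rhom_ext.
have E_comp (M N P : Lcat F) (psi : mor N P) (phi : mor M N) :
    E_map M P (psi ∘ phi) = E_map N P psi ∘ E_map M N phi.
  exact: Rhom_ext.
exists E_id, E_comp => E.
pose f' (M : Rcat G) n := tau_inv adj (Rmap M n).
have E'_sq0 (M : Rcat G) (n : int) : f' M (n + 1) ∘ fmap F (f' M n) = 0.
  by apply/(tau_comp_eq0 adj) => //; rewrite !tau_invK; exact: Rmap_sq0.
have E'_comm (M N : Rcat G) (phi : mor M N) (n : int) :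
    Rcomp phi (n + 1) ∘ f' M n = f' N n ∘ fmap F (Rcomp phi n).
  by apply/(tau_square_iff adj); rewrite !tau_invK; exact: Rcomp_comm.
pose E'_ob (M : Rcat G) : Lcat F := LObj (Lmap := f' M) (E'_sq0 M).
pose E'_map (M N : Rcat G) (phi : mor M N) : mor (E'_ob M) (E'_ob N) :=
  LHom (M := E'_ob M) (N := E'_ob N) (Lcomp := Rcomp phi) (E'_comm M N phi).
have E'_id M : E'_map M M (idm M) = idm (E'_ob M) by exact: Lhom_ext.
have E'_comp (M N P : Rcat G) (psi : mor N P) (phi : mor M N) :
    E'_map M P (psi ∘ phi) = E'_map N P psi ∘ E'_map M N phi.
  exact: Lhom_ext.
pose E' : functor (Rcat G) (Lcat F) :=
  Functor (fob := E'_ob) (fmap := E'_map) E'_id E'_comp.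
exists E'; split.
- have mapK (M : Lcat F) : f' (E_ob M) = Lmap M.
    by apply: functional_extensionality_dep => n; exact: tauK.
  have obK M : E'_ob (E_ob M) = M.
    by case: M (mapK M) => car f s /= fK; exact: LObj_eq.
  apply: (@eq_functor_id _ (functor_comp E' E) obK) => M N phi.
  apply: Lhom_ext => n /=.
  (* Transposing twice leaves the carrier of [P] unchanged up to conversion. *)
  have castE (P : Lcat F) : Lcomp (eqmor (obK P)) n = idm (P n).
    by rewrite Lcomp_eqmor; exact: eqmor_refl.
  by rewrite !castE comp1m compm1.
- have mapK (M : Rcat G) : (fun n => tau adj (f' M n)) = Rmap M.
    by apply: functional_extensionality_dep => n; exact: tau_invK.
  have obK M : E_ob (E'_ob M) = M.
    by case: M (mapK M) => car g s /= gK; exact: RObj_eq.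
  apply: (@eq_functor_id _ (functor_comp E E') obK) => M N phi.
  apply: Rhom_ext => n /=.
  have castE (P : Rcat G) : Rcomp (eqmor (obK P)) n = idm (P n).
    by rewrite Rcomp_eqmor; exact: eqmor_refl.
  by rewrite !castE comp1m compm1.
Qed.
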